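(* Let $U_i^n=(\varrho_i^n,M_i^n,E_i^n)\in\mathcal A$ for all $i\in\mathcal V$ (admissible state), let $F_i^{n+\frac12}\in\mathbb R^d$ for $i\in\mathcal V$, and let $\tau>0$ be arbitrary. Let $U_i^{n+1}=(\varrho_i^{n+1},M_i^{n+1},E_i^{n+1})$, $i\in\mathcal V$, be the state produced by the parabolic update (steps 1–6 of the context). Then $U_i^{n+1}\in\mathcal A$ for all $i\in\mathcal V$, and $$\varrho_i^{n+1}=\varrho_i^n>0\quad\forall i\in\mathcal V,$$ $$\min_{j\in\mathcal V}e_j^{n+1}\ \ge\ \min_{j\in\mathcal V}e_j^n\ >\ 0,$$ $$\sum_{i\in\mathcal V}m_iE_i^{n+1}=\sum_{i\in\mathcal V}m_iE_i^n+\sum_{i\in\mathcal V}\tau\,m_i\,F_i^{n+\frac12}\cdot V_i^{n+\frac12}.$$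
   Context: **Setting.** $d\in\{2,3\}$; $D\subset\mathbb R^d$ is a bounded polyhedral domain. A state is $u=(\rho,m,E)\in\mathbb R\times\mathbb R^d\times\mathbb R$, with velocity $v=\rho^{-1}m$ and specific internal energy $e(u)=\rho^{-1}E-\frac12|v|^2$; $\mathcal A=\{(\rho,m,E)\in\mathbb R^{d+2}:\rho>0,\ e(u)>0\}$. $P(\mathcal T_h)\subset C^0(\overline D)$ is a continuous Lagrange finite element space on a mesh $\mathcal T_h$ of $D$ with basis $\{\varphi_i\}_{i\in\mathcal V}$, $\varphi_i\ge0$, $\sum_i\varphi_i=1$. $\mathcal V$ is the disjoint union of the boundary degrees of freedom $\mathcal V^\partial$ (those located on $\partial D$) and the interior ones $\mathcal V^\circ$. $\mathcal I(i)=\{j\in\mathcal V:\varphi_i\varphi_j\not\equiv0\}$ and $m_i=\int_D\varphi_i\,dx$. Constants: $\mu>0$, $\lambda\ge0$, $\kappa>0$, $c_v>0$. Let $\varepsilon(v)=\frac12(\nabla v+(\nabla v)^{\mathsf T})$, $\mathbf s(v)=2\mu\varepsilon(v)+(\lambda-\frac23\mu)(\nabla\cdot v)I$, $a(v,w)=\int_D\mathbf s(v):\varepsilon(w)\,dx$, $(B_{ij})_{kl}=a(\varphi_j\mathbf e_l,\varphi_i\mathbf e_k)$ with $\mathbf e_k$ the canonical basis of $\mathbb R^d$, and $\beta_{ij}=c_v^{-1}\kappa\int_D\nabla\varphi_j\cdot\nabla\varphi_i\,dx$. It is assumed that $\beta_{ij}\le0$ for all $i\ne j$. **Parabolic update**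 with time step $\tau>0$. Put $V_i^n=M_i^n/\varrho_i^n$, $e_i^n=(\varrho_i^n)^{-1}E_i^n-\frac12|V_i^n|^2$. 1. $\varrho_i^{n+1}=\varrho_i^n$. 2. Solve for $(V_i^{n+1/2})_{i\in\mathcal V}$: $\varrho_i^nm_iV_i^{n+1/2}+\frac12\tau\sum_{j\in\mathcal I(i)}B_{ij}V_j^{n+1/2}=m_iM_i^n+\frac12\tau m_iF_i^{n+1/2}$ for $i\in\mathcal V^\circ$, and $V_i^{n+1/2}=0$ for $i\in\mathcal V^\partial$. Set $V_i^{n+1}=2V_i^{n+1/2}-V_i^n$, $M_i^{n+1}=\varrho_i^{n+1}V_i^{n+1}$, $v^{n+1/2}=\sum_iV_i^{n+1/2}\varphi_i$, $K_i^{n+1/2}=\frac1{m_i}\int_D\mathbf s(v^{n+1/2}):\varepsilon(v^{n+1/2})\varphi_i\,dx$. 3. Solve for $(e_i^{L,n+1})$: $m_i\varrho_i^n(e_i^{L,n+1}-e_i^n)+\tau\sum_{j\in\mathcal I(i)}\beta_{ij}e_j^{L,n+1}=\tau m_iK_i^{n+1/2}$ for all $i\in\mathcal V$. 4. Solve for $(e_i^{H,n+1/2})$: $m_i\varrho_i^n(e_i^{H,n+1/2}-e_i^n)+\frac12\tau\sum_{j\in\mathcal I(i)}\beta_{ij}e_j^{H,n+1/2}=\frac12\tau m_iK_i^{n+1/2}$ for all $i\in\mathcal V$; set $e_i^{H,n+1}=2e_i^{H,n+1/2}-e_i^n$. 5. Set $A_{ij}=-\frac12\tau\beta_{ij}\big(e_j^{H,n+1}-e_i^{H,n+1}+e_j^n-e_i^n-2e_j^{L,n+1}+2e_i^{L,n+1}\big)$,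 $e^{n,\min}=\min_{j\in\mathcal V}e_j^n$, $P_i^-=\sum_{j\in\mathcal I(i)\setminus\{i\}}\min(A_{ij},0)$, $Q_i^-=m_i\varrho_i^n(e^{n,\min}-e_i^{L,n+1})$, $\ell_i^+=1$, $\ell_i^-=\min(1,Q_i^-/P_i^-)$ (with $\ell_i^-=1$ if $P_i^-=0$), $\ell_{ij}=\min(\ell_i^+,\ell_j^-)$ if $A_{ij}\ge0$ and $\ell_{ij}=\min(\ell_i^-,\ell_j^+)$ if $A_{ij}<0$. Define $e_i^{n+1}$ by $m_i\varrho_i^n(e_i^{n+1}-e_i^{L,n+1})=\sum_{j\in\mathcal I(i)\setminus\{i\}}\ell_{ij}A_{ij}$. 6. $E_i^{n+1}=\varrho_i^{n+1}e_i^{n+1}+\frac12\varrho_i^n|V_i^{n+1}|^2$. *)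

(* Defs.v *)
From HB Require Import structures.
From mathcomp Require Import all_boot all_order all_algebra.
From mathcomp Require Import all_classical all_reals all_analysis.

Set Implicit Arguments.
Unset Strict Implicit.
Unset Printing Implicit Defensive.
Import Order.TTheory GRing.Theory Num.Theory.
Import numFieldNormedType.Exports.
Local Open Scope classical_set_scope.
Local Open Scope ring_scope.

(* Lebesgue measure on R^n, built by recursion on n as the image of the product
   measure on R * R^n under (x, t) |-> x :: t.  The recursion goes through
   sigma-finite measures, since the product needs a sigma-finite factor. *)
Section lebesgue_measure_tuple.
Variable R : realType.

Definition consT (n : nat) (p : R * n.-tuple R) : n.+1.-tuple R :=
  [tuple of p.1 :: p.2].

Lemma measurable_consT n : measurable_fun setT (@consT n).
Proof. exact: measurable_cons. Qed.

Section step.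
Variables (n : nat) (m : {sigma_finite_measure set (n.-tuple R) -> \bar R}).

Definition leb_step : set (n.+1.-tuple R) -> \bar R :=
  pushforward (lebesgue_measure \x m)%E (@consT n).

Let leb_step0 : leb_step set0 = 0%E.
Proof. by rewrite /leb_step /pushforward preimage_set0 measure0. Qed.

Let leb_step_ge0 A : (0 <= leb_step A)%E.
Proof. exact: (measure_ge0 (lebesgue_measure \x m)%E). Qed.

Let leb_step_sigma_additive : semi_sigma_additive leb_step.
Proof.
have mf A : measurable A -> measurable (@consT n @^-1` A).
  by move=> mA; rewrite -[X in measurable X]setTI; exact: measurable_consT.
move=> F mF tF mUF; rewrite /leb_step /pushforward preimage_bigcup.
apply: measure_semi_sigma_additive.
- by move=> k; exact: mf.
- apply/trivIsetP => /= i j _ _ ij; rewrite -preimage_setI.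
  by move/trivIsetP : tF => /(_ _ _ _ _ ij) ->//; rewrite preimage_set0.
- by rewrite -preimage_bigcup; exact: mf.
Qed.

HB.instance Definition _ := isMeasure.Build _ _ _ leb_step
  leb_step0 leb_step_ge0 leb_step_sigma_additive.

Lemma leb_step_sigma_finite : sigma_finite setT leb_step.
Proof.
have [F FT Foo] : sigma_finite setT (@lebesgue_measure R \x m)%E.
  have /sigma_finiteP[A [TA ndA Aoo]] := sigma_finiteT (@lebesgue_measure R).
  have /sigma_finiteP[B [TB ndB Boo]] := sigma_finiteT m.
  exists (fun k => A k `*` B k).
    rewrite -setXTT TA TB predeqE => -[x y]; split.
      move=> [/= [i _ Ax] [j _ By]]; exists (maxn i j) => //; split.
      - by move: x Ax; exact/subsetPset/ndA/leq_maxl.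
      - by move: y By; exact/subsetPset/ndB/leq_maxr.
    by move=> [k _ []/= ? ?]; split; exists k.
  move=> k; have [? ?] := Aoo k; have [? ?] := Boo k.
  split; first exact: measurableX.
  by rewrite product_measure1E// lte_mul_pinfty// ge0_fin_numE.
pose G (t : n.+1.-tuple R) : R * n.-tuple R := (thead t, [tuple of behead t]).
have mG : measurable_fun setT G.
  by apply/measurable_fun_pairP; split;
    [exact: measurable_tnth | exact: measurable_behead].
have GK p : G (consT p) = p.
  by case: p => x t; congr pair; apply/val_inj.
exists (fun k => G @^-1` F k).
  by rewrite -preimage_bigcup -FT preimage_setT.
move=> k; have [mF Fk] := Foo k; split.
  by rewrite -[X in measurable X]setTI; exact: mG.
rewrite /leb_step /pushforward.
suff -> : @consT n @^-1` (G @^-1` F k) = F k by [].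
by apply/seteqP; split=> p /=; rewrite GK.
Qed.

HB.instance Definition _ := Measure_isSigmaFinite.Build _ _ _ leb_step
  leb_step_sigma_finite.

End step.

Fixpoint leb (n : nat) : {sigma_finite_measure set (n.-tuple R) -> \bar R} :=
  if n is n'.+1 then leb_step (leb n') else dirac [tuple].

End lebesgue_measure_tuple.

Section geometry.
Variables (R : realType) (d : nat).
Notation point := 'rV[R]_d.

Definition point_of (t : d.-tuple R) : point := \row_i tnth t i.

Definition dintegral (D : set point) (f : point -> R) : R :=
  \int[leb R d]_(t in point_of @^-1` D) f (point_of t).

Definition negligible_set (A : set point) :=
  (leb R d).-negligible (point_of @^-1` A).

Definition frontier (A : set point) : set point := closure A `\` A°.

(* The convex hull of finitely many points. *)
Definition polytope n (a : 'I_n -> point) : set point :=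
  [set x | exists w : 'I_n -> R,
     [/\ forall i, 0 <= w i, \sum_i w i = 1 & x = \sum_i w i *: a i]].

Definition polyhedral (D : set point) :=
  exists (n : nat) (s : 'I_n -> nat) (a : forall k, 'I_(s k) -> point),
    frontier D = \bigcup_(k in [set: 'I_n]) polytope (a k).

Definition bounded_polyhedral_domain (D : set point) :=
  [/\ D !=set0, open D, connected D, bounded_set D & polyhedral D].

Definition dotv (u v : point) : R := \sum_k u 0 k * v 0 k.

(* The square of the Euclidean norm; the library norm of a row vector is the
   maximum norm. *)
Definition sqnorm (u : point) : R := dotv u u.

Definition frobenius (A B : 'M[R]_d) : R := \sum_k \sum_l A k l * B k l.

Definition unitv (k : 'I_d) : point := delta_mx 0 k.

End geometry.

Section finite_elements.
Variables (R : realType) (d : nat).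
Notation point := 'rV[R]_d.

(* A Lagrange finite element (K, P, Sigma) in the sense of Ciarlet: Sigma is the
   set of evaluations at the nodes, and P is unisolvent for it.  Functions of P
   are total, but only their values on K matter.  Neither the shape of K nor a
   reference element is fixed, so simplices, quadrilaterals, hexahedra, and any
   polynomial degree are covered; K only needs a null boundary, which every
   Lipschitz cell has, and P must lie in C^0(K), in C^1 of the interior of K, and
   in W^{1,oo}(K). *)
Record lagrange_element := LagrangeElement {
  cell : set point;
  ndof : nat;
  enode : 'I_ndof -> point;
  shape : set (point -> R);
  cell_compact : compact cell;
  cell_connected : connected cell;
  cell_interior : cell° !=set0;
  cell_frontier : negligible_set (frontier cell);
  enode_cell : forall k, cell (enode k);
  shape0 : shape (fun=> 0);
  shape_lin : forall (c : R) p q, shape p -> shape q ->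
    shape (fun x => c * p x + q x);
  shape_interp : forall c : 'I_ndof -> R,
    exists2 p, shape p & forall k, p (enode k) = c k;
  shape_unisolv : forall p, shape p -> (forall k, p (enode k) = 0) ->
    forall x, cell x -> p x = 0;
  shape_continuous : forall p, shape p -> {within cell, continuous p};
  shape_differentiable : forall p, shape p ->
    forall x, cell° x -> differentiable p x;
  shape_C1 : forall p, shape p -> forall l x, cell° x ->
    {for x, continuous (fun y => 'D_(unitv R l) p y)};
  shape_bounded : forall p, shape p ->
    exists C : R, forall l x, cell° x -> `|'D_(unitv R l) p x| <= C
}.

Record mesh (D : set point) := Mesh {
  ncell : nat;
  elt : 'I_ncell -> lagrange_element;
  mesh_cover : closure D = \bigcup_(K in [set: 'I_ncell]) cell (elt K);
  mesh_disjoint : forall K K', K != K' ->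
    (cell (elt K))° `&` (cell (elt K'))° = set0
}.

Definition cell_interiors D (T : mesh D) : set point :=
  \bigcup_(K in [set: 'I_(ncell T)]) (cell (elt K))°.

Definition fe_space D (T : mesh D) : set (point -> R) :=
  [set v | {within closure D, continuous v} /\
    forall K : 'I_(ncell T), exists2 p, shape (elt K) p &
      forall x, cell (elt K) x -> v x = p x].

(* The nodal basis, indexed by 'I_nnode.+1: there is at least one node since D is
   nonempty.  That phi is a basis of fe_space follows from unisolvence. *)
Record lagrange_basis (D : set point) (T : mesh D) := LagrangeBasis {
  nnode : nat;
  node : 'I_nnode.+1 -> point;
  phi : 'I_nnode.+1 -> point -> R;
  node_inj : injective node;
  nodeE : range node =
    \bigcup_(K in [set: 'I_(ncell T)]) range (@enode (elt K));
  phi_space : forall i, fe_space T (phi i);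
  phi_node : forall i j, phi i (node j) = (i == j)%:R;
  phi_ge0 : forall i x, closure D x -> 0 <= phi i x;
  phi_sum1 : forall x, closure D x -> \sum_i phi i x = 1
}.

Definition on_boundary D (T : mesh D) (X : lagrange_basis T)
  (i : 'I_(nnode X).+1) : Prop := frontier D (node i).

Section differential_operators.
Variables (D : set point) (T : mesh D).

(* Finite element functions are only piecewise differentiable: derivatives are
   taken in the interiors of the cells, which cover D up to a null set, and are
   set to 0 elsewhere. *)
Definition pderiv (W : normedModType R) (v : point -> W) (l : 'I_d)
    (x : point) : W :=
  if x \in cell_interiors T then 'D_(unitv R l) v x else 0.

Definition grad (f : point -> R) (x : point) : point :=
  \row_l pderiv f l x.

Definition vgrad (v : point -> point) (x : point) : 'M[R]_d :=
  \matrix_(k, l) pderiv v l x 0 k.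

Definition divergence (v : point -> point) (x : point) : R :=
  \sum_k pderiv v k x 0 k.

Definition strain (v : point -> point) (x : point) : 'M[R]_d :=
  2^-1 *: (vgrad v x + (vgrad v x)^T).

Variables mu lambda : R.

Definition stress (v : point -> point) (x : point) : 'M[R]_d :=
  (2 * mu) *: strain v x + ((lambda - 2 / 3 * mu) * divergence v x)%:M.

Definition viscous_form (v w : point -> point) : R :=
  dintegral D (fun x => frobenius (stress v x) (strain w x)).

End differential_operators.

End finite_elements.

Section state.
Variables (R : realType) (d : nat).

Definition state : Type := (R * 'rV[R]_d * R)%type.

Definition density (u : state) : R := u.1.1.
Definition momentum (u : state) : 'rV[R]_d := u.1.2.
Definition energy (u : state) : R := u.2.

Definition velocity (u : state) : 'rV[R]_d := (density u)^-1 *: momentum u.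

Definition internal_energy (u : state) : R :=
  (density u)^-1 * energy u - 2^-1 * sqnorm (velocity u).

Definition admissible : set state :=
  [set u | 0 < density u /\ 0 < internal_energy u].

End state.

Section parabolic_update.
Variables (R : realType) (d : nat) (D : set 'rV[R]_d) (T : mesh D).
Variable X : lagrange_basis T.
Variables mu lambda kappa cv : R.
Notation V := 'I_(nnode X).+1.

Definition minV (e : V -> R) : R := \big[Num.min/e ord0]_j e j.

Definition adj (i j : V) : bool :=
  `[< exists2 x, closure D x & phi i x * phi j x != 0 >].

Definition mass (i : V) : R := dintegral D (phi i).

Definition viscB (i j : V) : 'M[R]_d :=
  \matrix_(k, l) viscous_form T mu lambda
    (fun x => phi j x *: unitv R l) (fun x => phi i x *: unitv R k).

Definition beta_coef (i j : V) : R :=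
  cv^-1 * kappa *
  dintegral D (fun x => dotv (grad T (phi j) x) (grad T (phi i) x)).

(* B v for a velocity v stored as a row vector. *)
Definition applyB (B : 'M[R]_d) (v : 'rV[R]_d) : 'rV[R]_d := (B *m v^T)^T.

Section heating.
Variable Vh : V -> 'rV[R]_d.

Definition fe_velocity (x : 'rV[R]_d) : 'rV[R]_d := \sum_i phi i x *: Vh i.

Definition heating (i : V) : R :=
  (mass i)^-1 *
  dintegral D (fun x => frobenius (stress T mu lambda fe_velocity x)
                          (strain T fe_velocity x) * phi i x).

End heating.

Section limiter.
Variables (tau : R) (rho e eL eH : V -> R).

Definition fluxA (i j : V) : R :=
  - (2^-1 * tau * beta_coef i j *
     (eH j - eH i + e j - e i - 2 * eL j + 2 * eL i)).

Definition limP (i : V) : R :=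
  \sum_(j | adj i j && (j != i)) Num.min (fluxA i j) 0.

Definition limQ (i : V) : R := mass i * rho i * (minV e - eL i).

Definition ellp (i : V) : R := 1.

Definition ellm (i : V) : R :=
  if limP i == 0 then 1 else Num.min 1 (limQ i / limP i).

Definition ell (i j : V) : R :=
  if 0 <= fluxA i j then Num.min (ellp i) (ellm j)
  else Num.min (ellm i) (ellp j).

End limiter.

(* One step U |-> U1 of the update, with the forcing F and the intermediate
   quantities Vh = V^{n+1/2}, eL = e^{L,n+1}, eHh = e^{H,n+1/2}, and
   e1 = e^{n+1}. *)
Record is_parabolic_update (tau : R) (F : V -> 'rV[R]_d) (U : V -> state R d)
    (Vh : V -> 'rV[R]_d) (eL eHh e1 : V -> R) (U1 : V -> state R d) : Prop := {
  upd_density : forall i, density (U1 i) = density (U i);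
  upd_velocity_interior : forall i, ~ on_boundary i ->
    (density (U i) * mass i) *: Vh i
      + (2^-1 * tau) *: \sum_(j | adj i j) applyB (viscB i j) (Vh j)
    = mass i *: momentum (U i) + (2^-1 * tau * mass i) *: F i;
  upd_velocity_boundary : forall i, on_boundary i -> Vh i = 0;
  upd_momentum : forall i,
    momentum (U1 i) = density (U1 i) *: (2 *: Vh i - velocity (U i));
  upd_energy_low : forall i,
    mass i * density (U i) * (eL i - internal_energy (U i))
      + tau * \sum_(j | adj i j) beta_coef i j * eL j
    = tau * mass i * heating Vh i;
  upd_energy_high : forall i,
    mass i * density (U i) * (eHh i - internal_energy (U i))
      + 2^-1 * tau * \sum_(j | adj i j) beta_coef i j * eHh j
    = 2^-1 * tau * mass i * heating Vh i;
  upd_energy_limited : forall i,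
    let rho := fun j => density (U j) in
    let e := fun j => internal_energy (U j) in
    let eH := fun j => 2 * eHh j - e j in
    mass i * rho i * (e1 i - eL i)
    = \sum_(j | adj i j && (j != i))
        ell tau rho e eL eH i j * fluxA tau e eL eH i j;
  upd_energy : forall i,
    energy (U1 i) = density (U1 i) * e1 i
      + 2^-1 * density (U i) * sqnorm (2 *: Vh i - velocity (U i))
}.

End parabolic_update.

(* Main.v *)
Require Import Defs.
From mathcomp Require Import all_boot all_order all_algebra.
From mathcomp Require Import all_classical all_reals all_analysis.
From mathcomp Require Import measurable_realfun ring lra.
Import Order.TTheory GRing.Theory Num.Theory.
Import numFieldNormedType.Exports.
Local Open Scope classical_set_scope.
Local Open Scope ring_scope.

Set Implicit Arguments.
Unset Strict Implicit.
Unset Printing Implicit Defensive.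

(** The update splits the total energy into its internal and kinetic parts, and
    the conclusions rest on three separate mechanisms.

    Positivity of the internal energy.  The low-order internal energy solves an
    implicit heat equation whose conduction matrix has nonpositive off-diagonal
    entries and zero row sums (the basis functions sum to one, so their gradients
    sum to zero), with a nonnegative source: in dimension at most three the stress
    is dissipative because (tr A)^2 <= 3 |A|^2.  Looking at the node where the
    low-order energy is smallest gives a minimum principle for every time step
    [minimum_principle].  The limiter was designed so that the energy
    a node loses through antidiffusive fluxes never exceeds the room left above
    the old minimum, so the limited energy keeps the same lower bound
    [limited_energy_ge].

    Conservation of the internal energy up to heating.  The antidiffusive fluxes
    are antisymmetric and the limiter coefficients symmetric, so limiting moves
    energy around without creating any [sum_limited_flux]; conduction does not
    create energy either because the columns of its matrix sum to zero.  What is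
    left is tau times the total heating [internal_energy_balance].

    Balance of the kinetic energy.  The new velocity is the reflection of the old
    one through the midpoint velocity, so the kinetic increment is exactly twice
    the midpoint velocity dotted with its difference to the old one
    [sqnorm_reflection].  Testing the momentum equation with the midpoint velocity
    (which vanishes at boundary nodes, where the equation is not imposed) turns
    this increment into the work of the force minus the viscous work
    [kinetic_energy_balance].  By the partition of unity the nodal heating sums to
    the integral of the dissipation [sum_heating], and by bilinearity this is also
    the viscous work [viscous_work]; hence the two contributions cancel in the
    total energy.

    The analytic input is modest.  Derivatives of basis functions are bounded and
    continuous inside the cells, so every integrand is a bounded measurable
    function on a bounded open set and integrals are linear; lumped masses are
    positive because nonempty open sets have positive measure [mass_gt0].  Sums
    over neighbouring nodes may be replaced by sums over all nodes: if the product
    of two nonnegative basis functions vanishes, then at each point one of the two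
    is zero, hence minimal, and its gradient vanishes there [not_adj_grad]. *)

(** * Lebesgue measure of open sets of row vectors *)

Section lebesgue_measure_row.
Variable R : realType.

(** Balls of the maximum norm in tuple coordinates: products of intervals, whose
    measure is computable and which generate the topology of row vectors. *)
Definition box n (c : n.-tuple R) (r : R) : set (n.-tuple R) :=
  [set t | forall i, ball (tnth c i) r (tnth t i)].

Lemma measurable_box n (c : n.-tuple R) r : measurable (box c r).
Proof.
rewrite (_ : box c r =
  \bigcap_(i in [set: 'I_n]) ((@tnth n R)^~ i @^-1` ball (tnth c i) r)); last first.
  by apply/seteqP; split=> [t h i _|t h i]; [exact: h|exact: (h i)].
apply: fin_bigcap_measurable => [|i _]; first exact: finite_finset.
have := @measurable_tnth _ R n i measurableT (ball (tnth c i) r) (measurable_ball _ _).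
by rewrite setTI.
Qed.

(** The recursive definition of the measure splits off the first coordinate, so
    the volume of a box is obtained one interval at a time. *)
Lemma leb_box n (c : n.-tuple R) r : 0 <= r -> leb R n (box c r) = ((r *+ 2) ^+ n)%:E.
Proof.
move=> r0; elim: n c => [|n IHn] c.
  rewrite expr0 /= diracE mem_set//; first by move=> -[].
rewrite /= /leb_step /pushforward.
rewrite (_ : _ @^-1` _ = ball (thead c) r `*` box [tuple of behead c] r).
  rewrite product_measure1E; [|exact: measurable_ball|exact: measurable_box].
  rewrite IHn exprS EFinM; congr mule; exact: lebesgue_measure_ball.
apply/seteqP; split=> -[x t] /=.
  move=> h; split; first by have := h ord0; rewrite {2}/tnth /=.
  move=> i; have := h (lift ord0 i).
  by rewrite !(tnth_nth 0) /= nth_behead.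
move=> [h0 h] i; case: (unliftP ord0 i) => [j ->|->].
  by have := h j; rewrite !(tnth_nth 0) /= nth_behead.
by [].
Qed.

Variable d : nat.
Notation point := 'rV[R]_d.

Definition row_tuple (x : point) : d.-tuple R := [tuple x 0 i | i < d].

Lemma preimage_ball (x : point) e : 0 < e ->
  @point_of R d @^-1` ball x e = box (row_tuple x) e.
Proof.
move=> e0; apply/seteqP; split=> t.
  by move=> [_ h] i; have := h 0 i; rewrite mxE tnth_mktuple.
move=> h; split=> // i j; rewrite (ord1 i) mxE.
by have := h j; rewrite tnth_mktuple.
Qed.

(** An open set is the countable union of the boxes with rational centre and
    radius 1/(k+1) that it contains, and boxes are finite intersections of
    coordinate preimages. *)
Lemma measurable_preimage_open (A : set point) :
  open A -> measurable (@point_of R d @^-1` A).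
Proof.
move=> oA.
pose G (p : 'rV[rat]_d * nat) : set (d.-tuple R) :=
  if `[< ball (map_mx (@ratr R) p.1 : point) p.2.+1%:R^-1 `<=` A >]
  then box (row_tuple (map_mx (@ratr R) p.1)) p.2.+1%:R^-1 else set0.
have -> : @point_of R d @^-1` A = \bigcup_p G p.
  apply/seteqP; split=> t /=; last first.
    move=> [p _]; rewrite /G; case: asboolP => // BA.
    by rewrite -preimage_ball ?invr_gt0//; exact: BA.
  move=> At; have /nbhs_ballP[e /= e0 eA] := open_nbhs_nbhs (conj oA At).
  have [k kP] : exists k : nat, k.+1%:R^-1 < e / 2.
    have e2 : 0 < e / 2 by rewrite divr_gt0.
    have [k _ /(_ k (leqnn k)) kP] := near_infty_natSinv_lt (PosNum e2).
    by exists k.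
  have /choice[q qP] : forall i, exists q : rat,
      ball (tnth t i) k.+1%:R^-1 (ratr q : R).
    move=> i; have [|q] := @rat_in_itvoo R (tnth t i - k.+1%:R^-1) (tnth t i + k.+1%:R^-1).
      by rewrite ltrD2l gtrN// invr_gt0.
    by exists q; rewrite ball_itv.
  exists (\row_i q i, k) => //; rewrite /G; case: asboolP => /= [_ i|[]].
    by rewrite tnth_mktuple !mxE; apply/ball_sym.
  move=> y qy; apply: eA.
  (* t is within 1/(k+1) < e/2 of the rational centre, so the box fits in ball t e *)
  rewrite (splitr e); apply: ball_triangle; last exact: le_ball (ltW kP) _ qy.
  apply: (le_ball (ltW kP)); split; first by rewrite invr_gt0.
  by move=> i j; rewrite (ord1 i) !mxE.
apply: countable_bigcupT_measurable; first exact: countableP.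
by move=> p; rewrite /G; case: asboolP => _ //; exact: measurable_box.
Qed.

Lemma bounded_leb_fin (A : set point) : open A -> bounded_set A ->
  (leb R d (@point_of R d @^-1` A) < +oo)%E.
Proof.
move=> oA [M [_ MA]]; pose r := `|M| + 1.
have M0 := normr_ge0 M.
have r1 : 0 < r + 1 by rewrite /r; lra.
apply: (@le_lt_trans _ _ (leb R d (box (row_tuple 0) (r + 1)))).
  apply: le_measure; rewrite ?inE; [exact: measurable_preimage_open|exact: measurable_box|].
  rewrite -preimage_ball// => t At.
  rewrite mx_norm_ball /ball_/= sub0r normrN.
  apply: (@le_lt_trans _ _ r); last by rewrite ltrDl.
  by apply: MA At; rewrite /r (le_lt_trans (ler_norm M))// ltrDl.
by rewrite leb_box ?ltry// ltW.
Qed.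

Lemma open_leb_gt0 (A : set point) : open A -> A !=set0 ->
  (0 < leb R d (@point_of R d @^-1` A))%E.
Proof.
move=> oA [x Ax]; have /nbhs_ballP[e /= e0 eA] := open_nbhs_nbhs (conj oA Ax).
apply: (@lt_le_trans _ _ (leb R d (box (row_tuple x) e))).
  by rewrite leb_box ?ltW// lte_fin exprn_gt0// pmulrn_lgt0.
apply: le_measure; rewrite ?inE; [exact: measurable_box|exact: measurable_preimage_open|].
by rewrite -preimage_ball// => t /eA.
Qed.

Lemma continuous_measurable (O : set point) (f : point -> R) : open O ->
  {in O, continuous f} ->
  measurable_fun (@point_of R d @^-1` O) (f \o @point_of R d).
Proof.
move=> oO cf; apply: (measurability _ (RGenOpens.measurableE R)).
move=> _ [_ [a [b ->] <-]].
apply: (@measurable_preimage_open (O `&` f @^-1` `]a, b[)).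
rewrite setIC (open_setIS (f @^-1` _) oO).
move: cf; rewrite -(continuous_open_subspace f oO) => /continuousP.
by apply; exact: interval_open.
Qed.
End lebesgue_measure_row.

(** * Integration of bounded measurable functions over a bounded open set *)

Section tame_functions.
Variables (R : realType) (d : nat) (D : set 'rV[R]_d).
Notation point := 'rV[R]_d.

(** A class of integrands closed under sums and products, on which integration
    over a bounded open set is linear without further side conditions. *)
Definition tame (f : point -> R) : Prop :=
  measurable_fun (@point_of R d @^-1` D) (f \o @point_of R d) /\
  exists C : R, forall x, D x -> `|f x| <= C.

Lemma tame_cst c : tame (fun=> c).
Proof. by split; [exact: measurable_cst|exists `|c|]. Qed.

Lemma tameD f g : tame f -> tame g -> tame (fun x => f x + g x).
Proof.
move=> [mf [C fC]] [mg [C' gC]]; split; first exact: measurable_funD.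
exists (C + C') => x Dx.
by apply: (le_trans (ler_normD _ _)); apply: lerD; [exact: fC|exact: gC].
Qed.

Lemma tameM f g : tame f -> tame g -> tame (fun x => f x * g x).
Proof.
move=> [mf [C fC]] [mg [C' gC]]; split; first exact: measurable_funM.
exists (C * C') => x Dx.
by rewrite normrM ler_pM//; [exact: fC|exact: gC].
Qed.

Lemma tame_sum (I : Type) (r : seq I) (P : pred I) (f : I -> point -> R) :
  (forall i, tame (f i)) -> tame (fun x => \sum_(i <- r | P i) f i x).
Proof.
move=> tf; elim: r => [|i r IHr].
  rewrite (_ : (fun x => _) = fun=> 0); first exact: tame_cst.
  by apply/funext => x; rewrite big_nil.
rewrite (_ : (fun x => _) = fun x => (if P i then f i x else 0) + \sum_(j <- r | P j) f j x).
  by apply: tameD => //; case: (P i) => //; exact: tame_cst.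
by apply/funext => x; rewrite big_cons; case: (P i) => //; rewrite add0r.
Qed.

Hypotheses (oD : open D) (bD : bounded_set D).

Lemma tame_integrable f : tame f ->
  (leb R d).-integrable (@point_of R d @^-1` D) (EFin \o (f \o @point_of R d)).
Proof.
move=> [mf [C fC]]; apply: measurable_bounded_integrable => //.
- exact: measurable_preimage_open.
- exact: bounded_leb_fin.
- exists C; split; first exact: num_real.
  by move=> M CM t Dt; apply: (le_trans _ (ltW CM)); exact: fC.
Qed.

Lemma eq_dintegral (f g : point -> R) : (forall x, D x -> f x = g x) ->
  dintegral D f = dintegral D g.
Proof. by move=> fg; apply: eq_Rintegral => t; rewrite inE => /fg. Qed.

Lemma dintegral_ge0 (f : point -> R) : (forall x, D x -> 0 <= f x) ->
  0 <= dintegral D f.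
Proof. by move=> f0; apply: Rintegral_ge0 => t /f0. Qed.

Lemma dintegral0 : dintegral D (fun=> 0) = 0.
Proof. by rewrite /dintegral Rintegral_cst ?mul0r//; exact: measurable_preimage_open. Qed.

Lemma dintegralZl c f : tame f ->
  dintegral D (fun x => c * f x) = c * dintegral D f.
Proof.
by move=> tf; apply: RintegralZl; [exact: measurable_preimage_open|exact: tame_integrable].
Qed.

Lemma dintegralD f g : tame f -> tame g ->
  dintegral D (fun x => f x + g x) = dintegral D f + dintegral D g.
Proof.
move=> tf tg; apply: RintegralD;
  [exact: measurable_preimage_open|exact: tame_integrable..].
Qed.

Lemma dintegral_sum (I : Type) (r : seq I) (P : pred I) (f : I -> point -> R) :
  (forall i, tame (f i)) ->
  dintegral D (fun x => \sum_(i <- r | P i) f i x) =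
  \sum_(i <- r | P i) dintegral D (f i).
Proof.
move=> tf; elim: r => [|i r IHr].
  rewrite big_nil; apply: etrans dintegral0.
  by apply: eq_dintegral => x _; rewrite big_nil.
rewrite big_cons -IHr; case: ifP => Pi; last first.
  by apply: eq_dintegral => x _; rewrite big_cons Pi.
rewrite -dintegralD //; last exact: tame_sum.
by apply: eq_dintegral => x _; rewrite big_cons Pi.
Qed.

(** A nonnegative function that stays above c > 0 on a nonempty open subset has
    integral at least c times the positive measure of that subset. *)
Lemma dintegral_gt0 f (A : set point) c : tame f ->
  open A -> A !=set0 -> A `<=` D -> 0 < c -> (forall x, D x -> 0 <= f x) ->
  (forall x, A x -> c <= f x) -> 0 < dintegral D f.
Proof.
move=> tf oA A0 AD c0 f0 fc.
have pAD : @point_of R d @^-1` A `<=` @point_of R d @^-1` D by move=> t; exact: AD.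
have mA := measurable_preimage_open oA; have mD := measurable_preimage_open oD.
have lA : (leb R d (@point_of R d @^-1` A) \is a fin_num)%E.
  rewrite ge0_fin_numE//; apply: le_lt_trans (bounded_leb_fin oD bD).
  by apply: le_measure; rewrite ?inE.
have iA : (leb R d).-integrable (@point_of R d @^-1` A) (EFin \o (f \o @point_of R d)).
  by apply: integrableS (tame_integrable tf).
apply: (@lt_le_trans _ _ (c * fine (leb R d (@point_of R d @^-1` A)))).
  rewrite mulr_gt0// fine_gt0// open_leb_gt0//=.
  by rewrite -ge0_fin_numE.
rewrite -Rintegral_cst//.
apply: (@le_trans _ _ (\int[leb R d]_(t in @point_of R d @^-1` A) f (point_of t))).
  apply: le_Rintegral => //; last by move=> t; exact: fc.
  apply: measurable_bounded_integrable => //; first by rewrite -ge0_fin_numE.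
  exact: bounded_cst.
rewrite /dintegral /Rintegral fine_le//; try exact: integrable_fin_num.
  exact: (integrable_fin_num mD (tame_integrable tf)).
apply: ge0_subset_integral => //.
- by apply/measurable_EFinP; case: tf.
- by move=> t Dt; rewrite lee_fin; exact: f0.
Qed.

End tame_functions.

(** * Regularity of the nodal basis functions *)

Section local_minimum.
Variables (R : realType) (V : normedModType R).

(** Difference quotients at an interior minimum with value 0 have the sign of the
    increment, so their two-sided limit can be neither positive nor negative. *)
Lemma derive_at_zero_min (f : V -> R) (x v : V) : derivable f x v ->
  f x = 0 -> (\forall y \near x, 0 <= f y) -> 'D_v f x = 0.
Proof.
move=> df fx0 f0.
have g0 : \forall h \near (0 : R), 0 <= f (h *: v + x).
  have : (fun h : R => h *: v + x) @ 0 --> x.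
    rewrite -[X in _ --> X]add0r -(scale0r v); apply: cvgD; last exact: cvg_cst.
    by apply: cvgZr_tmp; exact: cvg_id.
  by move/(_ _ f0).
set L := 'D_v f x.
pose q (h : R) := h^-1 * (f (h *: v + x) - f x).
have cq : q @ 0^' --> L by exact: df.
(* any property of small nonzero increments holds at some e and - e at once *)
have sample (P : set R) : (\forall h \near 0^', P h) ->
    exists2 e : R, 0 < e & [/\ P e, P (- e), 0 <= f (e *: v + x) & 0 <= f (- e *: v + x)].
  rewrite near_withinE => Ph.
  have /nbhs_ballP[e /= e0 eP] : nbhs (0 : R)
      ([set h | h != 0 -> P h] `&` [set h | 0 <= f (h *: v + x)]).
    exact: filterI.
  have e2 : 0 < e / 2 by rewrite divr_gt0.
  have be : ball 0 e (e / 2) by rewrite /ball/= sub0r normrN gtr0_norm//; lra.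
  have bNe : ball 0 e (- (e / 2)) by rewrite /ball/= sub0r opprK gtr0_norm//; lra.
  exists (e / 2) => //; have [P1 f1] := eP _ be; have [P2 f2] := eP _ bNe.
  by split=> //; [apply: P1|apply: P2]; rewrite ?oppr_eq0 gt_eqF.
have [L0|L0|//] := ltgtP L 0.
  have /sample[e e0 []] : \forall h \near 0^', q h < 0 by exact: cvgr_lt cq _ L0.
  rewrite /q fx0 !subr0 => /[swap] _ + fe _.
  by rewrite ltNge mulr_ge0// invr_ge0 ltW.
have /sample[e e0 []] : \forall h \near 0^', 0 < q h by exact: cvgr_gt cq _ L0.
rewrite /q fx0 !subr0 => _ + _ fe.
have Ne0 : (- e)^-1 <= 0 by rewrite invr_le0 oppr_le0 ltW.
by rewrite ltNge (mulr_le0_ge0 Ne0 fe).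
Qed.

End local_minimum.

Section finite_element_basis.
Variables (R : realType) (d : nat) (D : set 'rV[R]_d).
Hypotheses (oD : open D).
Variables (T : mesh D) (X : lagrange_basis T).
Notation V := 'I_(nnode X).+1.
Notation point := 'rV[R]_d.
Notation O := (cell_interiors T).

Lemma open_cell_interiors : open O.
Proof. by apply: bigcup_open => K _; exact: open_interior. Qed.

Lemma cell_interiors_closure : O `<=` closure D.
Proof.
by move=> x [K _ Kx]; rewrite (mesh_cover T); exists K => //; exact: interior_subset.
Qed.

Lemma near_closure x : O x -> \forall y \near x, closure D y.
Proof.
move=> Ox; have := open_nbhs_nbhs (conj open_cell_interiors Ox).
by apply: filterS; exact: cell_interiors_closure.
Qed.

Lemma phi_le1 (i : V) x : closure D x -> phi i x <= 1.
Proof.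
move=> Dx; rewrite -(phi_sum1 X Dx) (bigD1 i)//= lerDl.
by apply: sumr_ge0 => j _; exact: phi_ge0.
Qed.

Lemma phi_continuous (i : V) : {in D, continuous (phi i)}.
Proof.
have [cphi _] := phi_space i.
rewrite -(continuous_open_subspace _ oD).
exact: (continuous_subspaceW (@subset_closure _ D)).
Qed.

Lemma tame_phi (i : V) : tame D (phi i).
Proof.
split; first exact: (continuous_measurable oD (@phi_continuous i)).
exists 1 => x /subset_closure Dx.
by rewrite ger0_norm ?phi_le1// phi_ge0.
Qed.

(** A basis function equals 1 at its node, which lies in the closure of D, so it
    exceeds 1/2 on a nonempty open part of D even when the node is on the boundary. *)
Lemma mass_gt0 (bD : bounded_set D) (i : V) : 0 < mass i.
Proof.
have cn : closure D (node i).
  have [K _ [k _ <-]] :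
      (\bigcup_(K in [set: 'I_(ncell T)]) range (@enode _ _ (elt K))) (node i).
    by rewrite -(nodeE X); exists i.
  by rewrite (mesh_cover T); exists K => //; exact: enode_cell.
have [+ _] := phi_space i; move=> /subspace_continuousP/(_ _ cn).
rewrite /from_subspace (phi_node i i) eqxx => /cvgr_gt/(_ 2^-1).
have h12 : 2^-1 < 1 :> R by lra.
move=> /(_ h12); rewrite near_withinE nearE => hU.
apply: (@dintegral_gt0 _ _ _ oD bD _ (D `&` [set x | closure D x -> 2^-1 < phi i x]°) 2^-1).
- exact: tame_phi.
- by apply: openI => //; exact: open_interior.
- by apply: cn; exact: nbhs_interior.
- by move=> x [].
- by rewrite invr_gt0.
- by move=> x /subset_closure; exact: phi_ge0.
- move=> x [Dx /interior_subset/=] h; apply/ltW/h; exact: subset_closure.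
Qed.

(** Near a point interior to a cell a basis function coincides with a shape
    function of that cell, in a neighbourhood of every nearby point; this transfers
    both derivatives and their continuity. *)
Lemma phi_cell (i : V) x : O x ->
  exists (K : 'I_(ncell T)) p, [/\ Defs.shape (elt K) p, (cell (elt K))° x &
    \forall y \near x, (cell (elt K))° y /\ {near y, p =1 phi i}].
Proof.
move=> [K _ Kx]; have [_ /(_ K)[p pS pE]] := phi_space i.
exists K, p; split=> //.
have : nbhs x (cell (elt K))°.
  by apply: open_nbhs_nbhs; split=> //; exact: open_interior.
apply: filterS => y Ky; split=> //.
have : nbhs y (cell (elt K))°.
  by apply: open_nbhs_nbhs; split=> //; exact: open_interior.
by apply: filterS => z /interior_subset Kz; rewrite pE.
Qed.

Lemma phi_derivable (i : V) x v : O x -> derivable (phi i) x v.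
Proof.
move=> Ox; have [K [p [pS Kx pE]]] := phi_cell i Ox.
have [_ pEx] := nbhs_singleton pE.
apply: (near_eq_derivable pEx); apply: diff_derivable.
exact: (shape_differentiable pS).
Qed.

(** The convention that derivatives are 0 outside the cell interiors makes the
    partial derivative the extension by zero of a function continuous on an open
    set; there are finitely many cells, so the cellwise bounds have a maximum. *)
Lemma tame_pderiv (i : V) l : tame D (pderiv T (phi i) l).
Proof.
split.
  rewrite (_ : _ \o _ = ('D_(unitv R l) (phi i) \o @point_of R d)
    \_ (@point_of R d @^-1` O)); last first.
    apply/funext => t; rewrite patchE /= /pderiv.
    by congr (if _ then _ else _).
  apply/measurable_restrict.
  - by apply: measurable_preimage_open; exact: open_cell_interiors.
  - exact: measurable_preimage_open.
  apply: (@continuous_measurable _ _ (D `&` O)).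
    by apply: openI => //; exact: open_cell_interiors.
  move=> x; rewrite inE => -[_ Ox]; have [K [p [pS Kx pE]]] := phi_cell i Ox.
  have := @shape_C1 _ _ _ p pS l x Kx.
  rewrite /prop_for /continuous_at -(near_eq_derive _ (nbhs_singleton pE).2).
  move=> cp; apply: cvg_trans cp; apply: (@near_eq_cvg _ _ (nbhs x)).
  near=> y; apply: near_eq_derive.
  by have [_] : (cell (elt K))° y /\ {near y, p =1 phi i} by near: y.
have /choice[C CP] : forall K : 'I_(ncell T), exists C : R,
    forall x, (cell (elt K))° x -> `|'D_(unitv R l) (phi i) x| <= C.
  move=> K; have [_ /(_ K)[p pS pE]] := phi_space i.
  have [C CP] := shape_bounded pS; exists C => x Kx.
  rewrite -(@near_eq_derive _ _ _ p); first exact: CP.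
  have : nbhs x (cell (elt K))°.
    by apply: open_nbhs_nbhs; split=> //; exact: open_interior.
  by apply: filterS => z /interior_subset Kz; rewrite pE.
exists (\big[Num.max/0]_K C K) => x _; rewrite /pderiv.
case: ifPn => [|_]; last by rewrite normr0; exact: bigmax_ge_id.
rewrite inE => -[K _ Kx]; apply: (le_trans (CP K x Kx)).
exact: le_bigmax.
Unshelve. all: end_near. Qed.

End finite_element_basis.

(** * Conduction, viscous work and heating *)

Lemma sqr_sum_le3 (R : realFieldType) n (f : 'I_n -> R) : (n <= 3)%N ->
  (\sum_k f k) ^+ 2 <= 3 * \sum_k f k ^+ 2.
Proof.
case: n f => [|[|[|[|//]]]] f _; rewrite ?(big_ord_recl, big_ord0) ?addr0.
- by rewrite expr2 mulr0 mulr0.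
- have := sqr_ge0 (f ord0); nra.
- move: (f _) (f _) => a b; have := sqr_ge0 (a - b); nra.
- move: (f _) (f _) (f _) => a b c.
  have := sqr_ge0 (a - b); have := sqr_ge0 (b - c); have := sqr_ge0 (a - c); nra.
Qed.

Lemma is_derive_scalel (R : numFieldType) (V W : normedModType R) (f : V -> R)
    (w : W) (x v : V) : derivable f x v ->
  is_derive x v (fun y => f y *: w) ('D_v f x *: w).
Proof.
move=> df.
suff dfw : (fun h => h^-1 *: (((fun y => f y *: w) \o shift x) (h *: v) - f x *: w))
    @ 0^' --> 'D_v f x *: w.
  by apply: DeriveDef; [exact: cvgP dfw|exact: cvg_lim dfw].
rewrite (_ : (fun h => _) = fun h =>
  (h^-1 *: ((f \o shift x) (h *: v) - f x)) *: w); last first.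
  by apply/funext => h /=; rewrite -scalerBl scalerA.
exact: cvgZr_tmp.
Qed.

Section strain_algebra.
Variables (R : realType) (d : nat) (mu lambda : R).

(** The pointwise linear constitutive law: the divergence is the trace of the
    strain, so the stress depends on the field through its strain only. *)
Definition stress_of (A : 'M[R]_d) : 'M[R]_d :=
  (2 * mu) *: A + ((lambda - 2 / 3 * mu) * \tr A)%:M.

Lemma stress_ofE (A : 'M[R]_d) k l : stress_of A k l =
  2 * mu * A k l + (lambda - 2 / 3 * mu) * \tr A * (k == l)%:R.
Proof. by rewrite /stress_of !mxE mulr_natr. Qed.

Lemma frobeniusE (A B : 'M[R]_d) : frobenius A B = \tr (A *m B^T).
Proof.
by apply: eq_bigr => k _; rewrite mxE; apply: eq_bigr => l _; rewrite mxE.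
Qed.

Lemma frobenius_stress_sum (I : finType) (a b : I -> R) (A B : I -> 'M[R]_d) :
  frobenius (stress_of (\sum_p a p *: A p)) (\sum_q b q *: B q) =
  \sum_p \sum_q (a p * b q) * frobenius (stress_of (A p)) (B q).
Proof.
have -> : stress_of (\sum_p a p *: A p) = \sum_p a p *: stress_of (A p).
  rewrite /stress_of scaler_sumr raddf_sum mulr_sumr raddf_sum -big_split.
  apply: eq_bigr => p _ /=; rewrite scalerDr !scalerA mxtraceZ scale_scalar_mx.
  by congr (_ *: _ + _%:M); ring.
rewrite frobeniusE mulmx_suml raddf_sum; apply: eq_bigr => p _ /=.
rewrite [(\sum_q _)^T]raddf_sum mulmx_sumr raddf_sum; apply: eq_bigr => q _ /=.
by rewrite frobeniusE linearZ /= -scalemxAl -scalemxAr !mxtraceZ mulrA.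
Qed.

(** The form is 2 mu (|A|^2 - (tr A)^2 / 3) + lambda (tr A)^2, and the bracket is
    nonnegative because the trace has at most three terms. *)
Lemma frobenius_stress_ge0 (A : 'M[R]_d) : (d <= 3)%N -> 0 <= mu -> 0 <= lambda ->
  0 <= frobenius (stress_of A) A.
Proof.
move=> d3 mu0 lambda0.
have fA : frobenius A A >= \sum_k A k k ^+ 2.
  apply: ler_sum => k _; rewrite (bigD1 k)//= -expr2 lerDl.
  by apply: sumr_ge0 => l _; rewrite -expr2 sqr_ge0.
have tA : (\tr A) ^+ 2 <= 3 * \sum_k A k k ^+ 2.
  exact: sqr_sum_le3.
have -> : frobenius (stress_of A) A =
    2 * mu * frobenius A A + (lambda - 2 / 3 * mu) * (\tr A) ^+ 2.
  rewrite !frobeniusE /stress_of mulmxDl mxtraceD -scalemxAl mxtraceZ; congr (_ + _).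
  by rewrite mul_scalar_mx mxtraceZ mxtrace_tr -mulrA expr2.
have := sqr_ge0 (\tr A); nra.
Qed.

End strain_algebra.

Section finite_element_fields.
Variables (R : realType) (d : nat) (D : set 'rV[R]_d).
Hypotheses (oD : open D) (bD : bounded_set D).
Variables (T : mesh D) (X : lagrange_basis T).
Variables (mu lambda kappa cv : R).
Notation V := 'I_(nnode X).+1.
Notation point := 'rV[R]_d.
Notation O := (cell_interiors T).
Implicit Types (i j : V) (w : V -> point).

Lemma stressE (v : point -> point) x :
  stress T mu lambda v x = stress_of mu lambda (strain T v x).
Proof.
rewrite /stress /stress_of /strain mxtraceZ mxtraceD mxtrace_tr.
congr (_ + (_ * _)%:M).
have -> : \tr (vgrad T v x) = divergence T v x by apply: eq_bigr => k _; rewrite mxE.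
by field.
Qed.

Lemma pderiv_sum_phi w l x :
  pderiv T (fun y => \sum_i phi i y *: w i) l x =
  \sum_i pderiv T (phi i) l x *: w i.
Proof.
rewrite /pderiv; case: ifPn => [|_]; last by rewrite big1// => i _; rewrite scale0r.
rewrite inE => Ox.
have dphi i : is_derive x (unitv R l) (fun y => phi i y *: w i)
    ('D_(unitv R l) (phi i) x *: w i).
  by apply: is_derive_scalel; exact: phi_derivable.
rewrite (_ : (fun y => _) = \sum_i (fun y => phi i y *: w i)); last first.
  by apply/funext => y; rewrite fct_sumE.
rewrite derive_sum; last by move=> i; apply: ex_derive.
by apply: eq_bigr => i _; rewrite derive_val.
Qed.

(** Basis functions are nonnegative, so a zero inside a cell is a minimum. *)
Lemma grad_zero i x l : closure D x -> phi i x = 0 -> pderiv T (phi i) l x = 0.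
Proof.
move=> Dx phi0; rewrite /pderiv; case: ifPn => //; rewrite inE => Ox.
apply: derive_at_zero_min => //; first exact: phi_derivable.
by apply: filterS (near_closure Ox) => y; exact: phi_ge0.
Qed.

Lemma sum_pderiv_phi l x : \sum_i pderiv T (@phi _ _ _ _ X i) l x = 0.
Proof.
rewrite /pderiv; case: (boolP (x \in O)) => [|_]; last by rewrite big1.
rewrite inE => Ox.
rewrite -(derive_sum (fun i => @phi_derivable _ _ _ _ X i x (unitv R l) Ox)).
rewrite (near_eq_derive (g := cst (1 : R))); first exact: derive_cst.
by apply: filterS (near_closure Ox) => y Dy; rewrite fct_sumE phi_sum1.
Qed.

(** Pointwise reason why the stiffness coefficients of non-neighbours vanish: one
    of the two factors is zero at x, hence has zero gradient there. *)
Lemma not_adj_grad i j x : ~~ adj i j -> closure D x ->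
  (forall l, pderiv T (phi i) l x = 0) \/ (forall l, pderiv T (phi j) l x = 0).
Proof.
move=> /asboolPn nij Dx.
have /eqP : phi i x * phi j x = 0.
  by apply: contrapT => /eqP p0; apply: nij; exists x.
rewrite mulf_eq0 => /orP[]/eqP p0; [left|right] => l; exact: grad_zero.
Qed.

Lemma beta_sym i j : beta_coef kappa cv i j = beta_coef kappa cv j i.
Proof.
apply: (congr1 ( *%R (cv^-1 * kappa))); apply: eq_dintegral => x _.
by apply: eq_bigr => k _; rewrite mulrC.
Qed.

Lemma tame_grad_dot i j :
  tame D (fun x => dotv (grad T (phi j) x) (grad T (phi i) x)).
Proof.
rewrite (_ : (fun x => _) =
  (fun x => \sum_k pderiv T (phi j) k x * pderiv T (phi i) k x)).
  by apply: tame_sum => k; apply: tameM; exact: tame_pderiv.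
by apply/funext => x; apply: eq_bigr => k _; rewrite !mxE.
Qed.

Lemma sum_beta i : \sum_j beta_coef kappa cv i j = 0.
Proof.
rewrite -mulr_sumr -(dintegral_sum oD bD); last by move=> j; exact: tame_grad_dot.
rewrite (_ : dintegral _ _ = 0) ?mulr0//.
apply: etrans (dintegral0 oD); apply: eq_dintegral => x _.
rewrite /dotv exchange_big big1//= => k _.
rewrite -mulr_suml (_ : \sum_j _ = 0) ?mul0r//.
by rewrite -[RHS](sum_pderiv_phi k x); apply: eq_bigr => j _; rewrite mxE.
Qed.

Lemma beta_not_adj i j : ~~ adj i j -> beta_coef kappa cv i j = 0.
Proof.
move=> nij; rewrite /beta_coef (_ : dintegral _ _ = 0) ?mulr0//.
apply: etrans (dintegral0 oD); apply: eq_dintegral => x /subset_closure Dx.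
rewrite /dotv big1// => k _; rewrite !mxE.
by have [->|->] := not_adj_grad nij Dx; rewrite ?mulr0 ?mul0r.
Qed.

(** Strain of the vector basis field phi_i e_m, indexed by the pair (i, m) so that
    a finite element field is a single sum over degrees of freedom. *)
Definition basis_strain (p : V * 'I_d) (x : point) : 'M[R]_d :=
  strain T (fun y => phi p.1 y *: unitv R p.2) x.

Lemma basis_strainE i m x k l : basis_strain (i, m) x k l =
  2^-1 * (pderiv T (phi i) l x * (k == m)%:R + pderiv T (phi i) k x * (l == m)%:R).
Proof.
have pE n : pderiv T (fun y => phi i y *: unitv R m) n x =
    pderiv T (phi i) n x *: unitv R m.
  transitivity (pderiv T (fun y => \sum_j phi j y *: ((j == i)%:R *: unitv R m)) n x).
    congr (pderiv T _ n x); apply/funext => y.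
    rewrite (bigD1 i)//= eqxx scale1r big1 ?addr0// => j /negPf->.
    by rewrite scale0r scaler0.
  rewrite pderiv_sum_phi (bigD1 i)//= eqxx scale1r big1 ?addr0// => j /negPf->.
  by rewrite scale0r scaler0.
by rewrite !mxE !pE !mxE !eqxx /=.
Qed.

Lemma strain_fe w x : strain T (fe_velocity w) x =
  \sum_(p : V * 'I_d) w p.1 0 p.2 *: basis_strain p x.
Proof.
apply/matrixP => k l; rewrite summxE.
rewrite (eq_bigr (fun p : V * 'I_d => w p.1 0 p.2 * (2^-1 *
  (pderiv T (phi p.1) l x * (k == p.2)%:R + pderiv T (phi p.1) k x * (l == p.2)%:R)))).
  rewrite -(pair_bigA _ (fun i m => w i 0 m * (2^-1 *
  (pderiv T (phi i) l x * (k == m)%:R + pderiv T (phi i) k x * (l == m)%:R)))) /=.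
  rewrite !mxE /fe_velocity !pderiv_sum_phi !summxE -big_split mulr_sumr /=.
  apply: eq_bigr => i _; rewrite !mxE.
  have dlt (f : 'I_d -> R) n : \sum_m f m * (n == m)%:R = f n.
    rewrite (bigD1 n)//= eqxx mulr1 big1 ?addr0// => m /negPf.
    by rewrite eq_sym => ->; rewrite mulr0.
  rewrite -[w i 0 k](dlt (w i 0)) -[w i 0 l](dlt (w i 0)) !mulr_sumr -big_split mulr_sumr /=.
  by apply: eq_bigr => m _; ring.
by move=> [i m] _; rewrite mxE basis_strainE.
Qed.

Lemma tame_basis_strain p k l : tame D (fun x => basis_strain p x k l).
Proof.
case: p => i m.
rewrite (_ : (fun x => _) = fun x => 2^-1 *
  (pderiv T (phi i) l x * (k == m)%:R + pderiv T (phi i) k x * (l == m)%:R)).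
  apply: tameM; first exact: tame_cst.
  by apply: tameD; apply: tameM; first [exact: tame_pderiv|exact: tame_cst].
by apply/funext => x; rewrite basis_strainE.
Qed.

Lemma tame_basis_power p q : tame D (fun x =>
  frobenius (stress_of mu lambda (basis_strain p x)) (basis_strain q x)).
Proof.
rewrite (_ : (fun x => _) = fun x => \sum_k \sum_l
  ((2 * mu) * basis_strain p x k l +
   ((lambda - 2 / 3 * mu) * (\sum_m basis_strain p x m m)) * (k == l)%:R)
  * basis_strain q x k l).
  apply: tame_sum => k; apply: tame_sum => l; apply: tameM; last exact: tame_basis_strain.
  apply: tameD; first by apply: tameM; [exact: tame_cst|exact: tame_basis_strain].
  apply: tameM; last exact: tame_cst.
  apply: tameM; first exact: tame_cst.
  by apply: tame_sum => m; exact: tame_basis_strain.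
apply/funext => x; apply: eq_bigr => k _; apply: eq_bigr => l _.
by rewrite stress_ofE.
Qed.

Definition dissipation w (x : point) : R :=
  frobenius (stress T mu lambda (fe_velocity w) x) (strain T (fe_velocity w) x).

Lemma dissipationE w x : dissipation w x =
  \sum_p \sum_q (w p.1 0 p.2 * w q.1 0 q.2) *
    frobenius (stress_of mu lambda (basis_strain p x)) (basis_strain q x).
Proof. by rewrite /dissipation stressE strain_fe frobenius_stress_sum. Qed.

Lemma tame_dissipation w : tame D (dissipation w).
Proof.
rewrite (_ : dissipation w = fun x => \sum_p \sum_q (w p.1 0 p.2 * w q.1 0 q.2) *
    frobenius (stress_of mu lambda (basis_strain p x)) (basis_strain q x)).
  apply: tame_sum => p; apply: tame_sum => q.
  by apply: tameM; [exact: tame_cst|exact: tame_basis_power].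
by apply/funext => x; exact: dissipationE.
Qed.

Lemma viscB_not_adj i j : ~~ adj i j -> viscB mu lambda i j = 0.
Proof.
move=> nij; apply/matrixP => k l; rewrite !mxE.
apply: etrans (dintegral0 oD); apply: eq_dintegral => x /subset_closure Dx.
rewrite stressE -/(basis_strain (j, l) x) -/(basis_strain (i, k) x) frobeniusE.
have b0 (n : V) m : (forall l', pderiv T (phi n) l' x = 0) -> basis_strain (n, m) x = 0.
  by move=> h; apply/matrixP => a b; rewrite basis_strainE !h !mxE !mul0r addr0 mulr0.
have [/b0 ->|/b0 ->] := not_adj_grad nij Dx.
  by rewrite trmx0 mulmx0 mxtrace0.
by rewrite /stress_of mxtrace0 mulr0 scaler0 add0r raddf0 mul0mx mxtrace0.
Qed.

(** Both sides expand over pairs of vector degrees of freedom: the left one by the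
    definition of the stiffness blocks, the right one by bilinearity of the
    pointwise dissipation, since the strain is linear in the nodal values. *)
Lemma viscous_work w :
  \sum_i dotv (w i) (\sum_(j | adj i j) applyB (viscB mu lambda i j) (w j)) =
  dintegral D (dissipation w).
Proof.
rewrite (eq_dintegral (g := fun x => \sum_p \sum_q (w p.1 0 p.2 * w q.1 0 q.2) *
    frobenius (stress_of mu lambda (basis_strain p x)) (basis_strain q x))); last first.
  by move=> x _; exact: dissipationE.
rewrite (dintegral_sum oD bD); last first.
  move=> p; apply: tame_sum => q.
  by apply: tameM; [exact: tame_cst|exact: tame_basis_power].
have -> : \sum_p dintegral D (fun x => \sum_q (w p.1 0 p.2 * w q.1 0 q.2) *
    frobenius (stress_of mu lambda (basis_strain p x)) (basis_strain q x)) =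
   \sum_p \sum_q (w p.1 0 p.2 * w q.1 0 q.2) * viscB mu lambda q.1 p.1 q.2 p.2.
  apply: eq_bigr => p _; rewrite (dintegral_sum oD bD); last first.
    by move=> q; apply: tameM; [exact: tame_cst|exact: tame_basis_power].
  apply: eq_bigr => q _; rewrite (dintegralZl oD bD); last exact: tame_basis_power.
  rewrite mxE; apply: (congr1 ( *%R _)); apply: eq_dintegral => x _.
  by rewrite stressE.
rewrite [RHS]exchange_big /=.
rewrite -(pair_bigA _ (fun i k =>
  \sum_p (w p.1 0 p.2 * w i 0 k) * viscB mu lambda i p.1 k p.2)) /=.
apply: eq_bigr => i _; apply: eq_bigr => k _.
rewrite summxE big_mkcond mulr_sumr /=.
rewrite -(pair_bigA _ (fun j l => (w j 0 l * w i 0 k) * viscB mu lambda i j k l)) /=.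
apply: eq_bigr => j _; case: ifPn => [_|/viscB_not_adj->].
  by rewrite !mxE mulr_sumr; apply: eq_bigr => l _; rewrite !mxE; ring.
by rewrite mulr0 big1// => l _; rewrite mxE mulr0.
Qed.

(** The lumped mass cancels the normalization of the nodal heating, and the weights
    phi_i sum to one. *)
Lemma sum_heating w : \sum_i mass i * heating mu lambda w i = dintegral D (dissipation w).
Proof.
transitivity (\sum_(i : V) dintegral D (fun x => dissipation w x * phi i x)).
  by apply: eq_bigr => i _; rewrite /heating mulVKf// gt_eqF// mass_gt0.
rewrite -(dintegral_sum oD bD).
  by apply: eq_dintegral => x Dx; rewrite -mulr_sumr phi_sum1 ?mulr1//; exact: subset_closure.
by move=> i; apply: tameM; [exact: tame_dissipation|exact: tame_phi].
Qed.

Lemma heating_ge0 w i : (d <= 3)%N -> 0 <= mu -> 0 <= lambda ->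
  0 <= heating mu lambda w i.
Proof.
move=> d3 mu0 l0; rewrite mulr_ge0 ?invr_ge0 ?(ltW (mass_gt0 oD bD _))//.
apply: dintegral_ge0 => x Dx; rewrite mulr_ge0//; last exact/phi_ge0/subset_closure.
by rewrite stressE frobenius_stress_ge0.
Qed.

End finite_element_fields.

(** * Minimum principle and flux limiting *)

(** At the index k where eL is smallest, zero row sums turn the coupling into
    \sum_j b k j (eL j - eL k) <= 0, so a k (eL k - e k) is at least h k >= 0. *)
Lemma minimum_principle (R : realFieldType) n (a e eL h : 'I_n.+1 -> R)
    (b : 'I_n.+1 -> 'I_n.+1 -> R) (c : R) :
  (forall i, 0 < a i) -> (forall i j, i != j -> b i j <= 0) ->
  (forall i, \sum_j b i j = 0) -> (forall i, 0 <= h i) ->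
  (forall i, a i * (eL i - e i) + \sum_j b i j * eL j = h i) ->
  (forall i, c <= e i) -> forall i, c <= eL i.
Proof.
move=> a0 b0 sb h0 eLE ce i.
have [k _ kmin] := @arg_minP _ _ _ ord0 xpredT eL isT.
apply: le_trans (kmin i isT); apply: le_trans (ce k) _.
rewrite -subr_ge0 -(pmulr_rge0 _ (a0 k)).
have -> : a k * (eL k - e k) = h k - \sum_j b k j * (eL j - eL k).
  under [X in _ = _ - X]eq_bigr do rewrite mulrBr.
  by rewrite -(eLE k) sumrB -mulr_suml sb mul0r subr0 addrK.
rewrite subr_ge0 (le_trans _ (h0 k))//; apply: sumr_le0 => j _.
have [->|jk] := eqVneq j k; first by rewrite subrr mulr0.
by rewrite mulr_le0_ge0 ?subr_ge0 ?kmin// b0// eq_sym.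
Qed.

Section limiter.
Variables (R : realType) (d : nat) (D : set 'rV[R]_d) (T : mesh D).
Variables (X : lagrange_basis T) (kappa cv tau : R).
Notation V := 'I_(nnode X).+1.
Variables (rho e eL eH : V -> R).
Implicit Types i j : V.

Lemma minV_le (f : V -> R) j : minV f <= f j.
Proof. exact: bigmin_le. Qed.

Lemma le_minV (c : R) (f : V -> R) : (forall j, c <= f j) -> c <= minV f.
Proof. by move=> cf; apply: le_bigmin. Qed.

Lemma lt_minV (c : R) (f : V -> R) : (forall j, c < f j) -> c < minV f.
Proof. by move=> cf; apply: lt_bigmin. Qed.

Lemma adj_sym i j : adj i j = adj j i.
Proof.
by apply/asboolP/asboolP => -[x Dx p0]; exists x => //; rewrite mulrC.
Qed.

Local Notation A := (fluxA kappa cv tau e eL eH).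
Local Notation P := (limP kappa cv tau e eL eH).
Local Notation Q := (limQ rho e eL).
Local Notation l := (ell kappa cv tau rho e eL eH).
Local Notation lm := (ellm kappa cv tau rho e eL eH).

(** The conduction coefficients are symmetric and the bracket is a difference of
    nodal values. *)
Lemma fluxA_antisym i j : A j i = - A i j.
Proof. by rewrite /fluxA beta_sym; ring. Qed.

Lemma limP_le0 i : P i <= 0.
Proof. by apply: sumr_le0 => j _; rewrite ge_min lexx orbT. Qed.

Hypothesis m0 : forall i : V, 0 < mass i.
Hypothesis rho0 : forall i, 0 < rho i.
Hypothesis eL_min : forall i, minV e <= eL i.

Lemma limQ_le0 i : Q i <= 0.
Proof. by rewrite mulr_ge0_le0 ?subr_le0// ltW// mulr_gt0. Qed.

Lemma ellm_itv i : 0 <= lm i <= 1.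
Proof.
rewrite /ellm; case: ifP => [_|_]; first by rewrite lexx ler01.
by rewrite ge_min lexx /= le_min ler01 mulr_le0 ?limQ_le0// invr_le0 limP_le0.
Qed.

(** The choice min(1, Q/P), with P <= 0 and Q <= 0, is what keeps the negative
    fluxes after scaling above Q. *)
Lemma ellm_limP i : Q i <= lm i * P i.
Proof.
rewrite /ellm; case: eqP => [->|/eqP P0]; first by rewrite mulr0 limQ_le0.
have Pn : P i < 0 by rewrite lt_neqAle P0 limP_le0.
by rewrite -ler_ndivlMr// ge_min lexx orbT.
Qed.

(** Reversing an edge exchanges the roles of the two limiters: on both sides the
    coefficient is the lower limiter of the node that loses energy.  The case
    distinction in the definition is not symmetric at a zero flux, where the
    product vanishes anyway. *)
Lemma ell_fluxA_antisym i j : l j i * A j i = - (l i j * A i j).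
Proof.
have [A0|A0|A0] := ltgtP (A i j) 0; last by rewrite fluxA_antisym A0 oppr0 !mulr0 oppr0.
- rewrite fluxA_antisym mulrN; congr (- (_ * _)).
  by rewrite /ell fluxA_antisym oppr_ge0 (ltW A0) leNgt A0 /= minC.
- rewrite fluxA_antisym mulrN; congr (- (_ * _)).
  by rewrite /ell fluxA_antisym oppr_ge0 (ltW A0) leNgt A0 /= minC.
Qed.

Lemma sum_limited_flux :
  \sum_i \sum_(j | adj i j && (j != i)) l i j * A i j = 0.
Proof.
set S := LHS; have : S = - S; last by lra.
rewrite {1}/S (exchange_big_dep xpredT)//= /S -sumrN; apply: eq_bigr => j _.
rewrite -sumrN; apply: eq_big => [i|i _]; first by rewrite adj_sym eq_sym.
by rewrite -ell_fluxA_antisym.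
Qed.

(** Positive fluxes only help, and each negative flux is scaled by the lower
    limiter of node i, which bounds their sum below by Q. *)
Lemma limited_flux_ge i :
  Q i <= \sum_(j | adj i j && (j != i)) l i j * A i j.
Proof.
apply: le_trans (ellm_limP i) _; rewrite mulr_sumr; apply: ler_sum => j _.
have /andP[l0 l1] := ellm_itv i; have /andP[l0' l1'] := ellm_itv j.
rewrite /ell /ellp; have [A0|A0] := leP 0 (A i j).
  by rewrite mulr0 mulr_ge0// le_min ler01.
by rewrite (min_idPl l1).
Qed.

Lemma limited_energy_ge (e1 : V -> R) :
  (forall i, mass i * rho i * (e1 i - eL i) =
    \sum_(j | adj i j && (j != i)) l i j * A i j) ->
  forall i, minV e <= e1 i.
Proof.
move=> e1E i; have := limited_flux_ge i; rewrite -e1E /limQ.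
by rewrite ler_pM2l ?mulr_gt0// lerD2r.
Qed.

End limiter.

(** * Energy balances of the update *)

Section dot_product.
Variables (R : realType) (d : nat).
Implicit Types u v w : 'rV[R]_d.

Lemma dotvC u v : dotv u v = dotv v u.
Proof. by apply: eq_bigr => k _; rewrite mulrC. Qed.

Lemma dotvDr u v w : dotv u (v + w) = dotv u v + dotv u w.
Proof. by rewrite -big_split; apply: eq_bigr => k _; rewrite mxE mulrDr. Qed.

Lemma dotvZr a u v : dotv u (a *: v) = a * dotv u v.
Proof. by rewrite mulr_sumr; apply: eq_bigr => k _; rewrite mxE mulrCA. Qed.

Lemma dotv0l u : dotv 0 u = 0.
Proof. by apply: big1 => k _; rewrite mxE mul0r. Qed.

(** The vector 2 u - v is the reflection of v through u. *)
Lemma sqnorm_reflection u v :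
  2^-1 * sqnorm (2 *: u - v) = 2^-1 * sqnorm v + 2 * dotv u (u - v).
Proof.
rewrite /sqnorm /dotv !mulr_sumr -big_split; apply: eq_bigr => k _.
by rewrite !mxE /=; field.
Qed.

End dot_product.

Section energy_balance.
Variables (R : realType) (d : nat) (D : set 'rV[R]_d).
Hypotheses (oD : open D) (bD : bounded_set D).
Variables (T : mesh D) (X : lagrange_basis T).
Variables (mu lambda kappa cv tau : R).
Notation V := 'I_(nnode X).+1.
Variables (U U1 : V -> state R d) (F Vh : V -> 'rV[R]_d) (eL eHh e1 : V -> R).
Hypothesis hU : forall i, admissible (U i).
Hypothesis upd : is_parabolic_update mu lambda kappa cv tau F U Vh eL eHh e1 U1.

Let rho i := density (U i).
Let e i := internal_energy (U i).

Lemma momentumE (u : state R d) : admissible u -> momentum u = density u *: velocity u.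
Proof. by move=> [u0 _]; rewrite scalerA mulfV ?scale1r// gt_eqF. Qed.

Lemma energyE (u : state R d) : admissible u ->
  energy u = density u * internal_energy u + 2^-1 * density u * sqnorm (velocity u).
Proof.
move=> [u0 _]; rewrite /internal_energy mulrBr mulrA mulfV ?gt_eqF// mul1r.
by rewrite mulrCA mulrA subrK.
Qed.

Lemma upd_velocity i : velocity (U1 i) = 2 *: Vh i - velocity (U i).
Proof.
have [r0 _] := hU i.
by rewrite /velocity (upd_momentum upd) scalerA mulVf ?scale1r// (upd_density upd) gt_eqF.
Qed.

Lemma upd_internal_energy i : internal_energy (U1 i) = e1 i.
Proof.
have [r0 _] := hU i.
rewrite /internal_energy upd_velocity (upd_energy upd) (upd_density upd).
have rn : density (U i) != 0 by rewrite gt_eqF.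
set r := density _ in rn *; set s := sqnorm _.
by field.
Qed.

(** Take the dot product of the momentum equation with the midpoint velocity and
    sum; at boundary nodes the midpoint velocity is zero and all terms vanish. *)
Lemma kinetic_energy_balance :
  \sum_i mass i * rho i * (2 * dotv (Vh i) (Vh i - velocity (U i))) =
  \sum_i tau * mass i * dotv (F i) (Vh i) - tau * \sum_i mass i * heating mu lambda Vh i.
Proof.
rewrite sum_heating// -viscous_work// mulr_sumr -sumrB; apply: eq_bigr => i _.
have [bi|ni] := pselect (on_boundary i).
  by rewrite (upd_velocity_boundary upd bi) !dotv0l [dotv (F i) _]dotvC dotv0l !mulr0 subr0.
have /(congr1 (dotv (Vh i))) := upd_velocity_interior upd ni.
rewrite (momentumE (hU i)); move: (velocity (U i)) => v.
rewrite !dotvDr !dotvZr -scaleN1r dotvZr [dotv (F i) _]dotvC /rho.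
set a := dotv _ _; set b := dotv _ (\sum_(j | _) _); set c := dotv _ _; set f := dotv _ _.
move=> h.
(* twice the residual of the momentum equation, with the viscous term split off *)
have -> : mass i * density (U i) * (2 * (a + -1 * c)) =
  2 * (density (U i) * mass i * a + 2^-1 * tau * b - mass i * (density (U i) * c)) - tau * b.
  by field.
by rewrite h; field.
Qed.

(** The limited fluxes and the conduction terms both sum to zero over all nodes,
    so only the heating survives. *)
Lemma internal_energy_balance : 
  \sum_i mass i * rho i * (e1 i - e i) = tau * \sum_i mass i * heating mu lambda Vh i.
Proof.
have -> : \sum_i mass i * rho i * (e1 i - e i) =
    \sum_i mass i * rho i * (eL i - e i) + \sum_i mass i * rho i * (e1 i - eL i).
  by rewrite -big_split; apply: eq_bigr => i _ /=; ring.
rewrite [X in _ + X](eq_bigr _ (fun i _ => upd_energy_limited upd i)).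
rewrite sum_limited_flux addr0.
rewrite (eq_bigr (fun i => tau * mass i * heating mu lambda Vh i -
    tau * \sum_j beta_coef kappa cv i j * eL j)); last first.
  move=> i _; rewrite -(upd_energy_low upd i) [X in _ + tau * X - _]big_mkcond.
  rewrite [X in _ + tau * X - _](eq_bigr (fun j => beta_coef kappa cv i j * eL j)) ?addrK//.
  by move=> j _; case: ifPn => // /(beta_not_adj oD kappa cv) ->; rewrite mul0r.
(* the matrix is symmetric, so its columns sum to zero like its rows *)
have conduction0 : \sum_i \sum_j beta_coef kappa cv i j * eL j = 0.
  rewrite exchange_big big1//= => j _.
  rewrite -mulr_suml (eq_bigr (fun i => beta_coef kappa cv j i)).
    by rewrite sum_beta// mul0r.
  by move=> i _; rewrite beta_sym.
rewrite sumrB -[X in _ - X]mulr_sumr conduction0 mulr0 subr0 mulr_sumr.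
by apply: eq_bigr => i _; rewrite mulrA.
Qed.

(** The heating gained by the internal energy is the dissipation lost by the
    kinetic energy. *)
Lemma total_energy_balance :
  \sum_i mass i * energy (U1 i) =
  \sum_i mass i * energy (U i) + \sum_i tau * mass i * dotv (F i) (Vh i).
Proof.
have -> : \sum_i mass i * energy (U1 i) = \sum_i mass i * energy (U i) +
   (\sum_i mass i * rho i * (e1 i - e i) +
    \sum_i mass i * rho i * (2 * dotv (Vh i) (Vh i - velocity (U i)))).
  rewrite -!big_split; apply: eq_bigr => i _ /=.
  rewrite (upd_energy upd) (upd_density upd) (energyE (hU i)) -/(rho i) -/(e i).
  have := sqnorm_reflection (Vh i) (velocity (U i)).
  set s := sqnorm _; set t := sqnorm _ => h.
  by rewrite [2^-1 * rho i * s]mulrAC h; field.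
by rewrite internal_energy_balance kinetic_energy_balance; congr (_ + _); rewrite addrC subrK.
Qed.

End energy_balance.

Theorem theorem5p5 (R : realType) (d : nat) (hd : d = 2%N \/ d = 3%N)
    (D : set 'rV[R]_d) (hD : bounded_polyhedral_domain D)
    (T : mesh D) (X : lagrange_basis T)
    (mu lambda kappa cv : R) (hmu : 0 < mu) (hlambda : 0 <= lambda)
    (hkappa : 0 < kappa) (hcv : 0 < cv)
    (hbeta : forall i j : 'I_(nnode X).+1, i != j -> beta_coef kappa cv i j <= 0)
    (tau : R) (htau : 0 < tau)
    (U : 'I_(nnode X).+1 -> state R d) (hU : forall i, admissible (U i))
    (F : 'I_(nnode X).+1 -> 'rV[R]_d)
    (Vh : 'I_(nnode X).+1 -> 'rV[R]_d)
    (eL eHh e1 : 'I_(nnode X).+1 -> R)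
    (U1 : 'I_(nnode X).+1 -> state R d)
    (hupd : is_parabolic_update mu lambda kappa cv tau F U Vh eL eHh e1 U1) :
  [/\ forall i, admissible (U1 i),
      forall i, density (U1 i) = density (U i) /\ 0 < density (U i),
      minV (fun j => internal_energy (U j)) <= minV e1 /\
        0 < minV (fun j => internal_energy (U j)) &
      \sum_i mass i * energy (U1 i) =
        \sum_i mass i * energy (U i)
        + \sum_i tau * mass i * dotv (F i) (Vh i)].
Proof.
have [_ oD _ bD _] := hD.
have d3 : (d <= 3)%N by case: hd => ->.
have rho0 i : 0 < density (U i) by have [] := hU i.
have m0 i := mass_gt0 oD bD (i : 'I_(nnode X).+1).
pose e i := internal_energy (U i).
have e0 : 0 < minV e by apply: lt_minV => i; have [] := hU i.
have eL_min : forall i, minV e <= eL i.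
  apply: (@minimum_principle _ _ (fun i => mass i * density (U i)) e eL
    (fun i => tau * mass i * heating mu lambda Vh i)
    (fun i j => tau * beta_coef kappa cv i j)).
  - by move=> i; rewrite mulr_gt0.
  - by move=> i j ij; rewrite mulr_ge0_le0 ?hbeta// ltW.
  - by move=> i; rewrite -mulr_sumr sum_beta// mulr0.
  - move=> i; rewrite mulr_ge0//; first by rewrite ltW// mulr_gt0.
    by rewrite heating_ge0// ltW.
  - move=> i; rewrite -(upd_energy_low hupd i); congr (_ + _).
    rewrite mulr_sumr [RHS]big_mkcond; apply: eq_bigr => j _.
    by case: ifPn => [_|/(beta_not_adj oD kappa cv) ->]; rewrite ?mulr0 ?mul0r// mulrA.
  - exact: minV_le.
have e1_min i : minV e <= e1 i.
  exact: (limited_energy_ge m0 rho0 eL_min (upd_energy_limited hupd)).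
split.
- move=> i; split; first by rewrite (upd_density hupd).
  by rewrite (upd_internal_energy hU hupd) (lt_le_trans e0).
- by move=> i; rewrite (upd_density hupd).
- by split=> //; apply: le_minV.
- exact: (total_energy_balance oD bD hU hupd).
Qed.
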